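(* For every integer $n\ge 0$ and every real $x$, the function $\psi^{(n)}(x)$ exists in the neutrix sense; that is, the neutrix limit $$\mathop{\mathrm{N\!-\!lim}}_{\varepsilon\to 0}\int_\varepsilon^{1-\varepsilon}\frac{t^{x-1}}{1-t}\,\ln^n t\,dt$$ exists.
   Context: Neutrix limit. Let $N$ be the set of negligible functions on the domain $\{\varepsilon : 0<\varepsilon<\tfrac12\}$ with real values: $N$ consists of all functions that are sums of a finite (real) linear combination of the functions $$\varepsilon^{\lambda}\ln^{r-1}\varepsilon,\qquad \ln^r\varepsilon\qquad(\lambda<0 \text{ real},\ r=1,2,\ldots)$$ and a function $f(\varepsilon)$ that converges to zero in the usual sense as $\varepsilon\to 0^+$. For a real-valued function $f$ on this domain, if there is a constant $c$ such that $f(\varepsilon)-c$ belongs to $N$, then $c$ is called the neutrix limit of $f(\varepsilon)$ as $\varepsilon\to 0$, written $\mathop{\mathrm{N\!-\!lim}}_{\varepsilon\to 0} f(\varepsilon)=c$, and the neutrix limit is said to exist. The polygamma function has, for $x>0$ and $n\ge1$, the integral representation $\psi^{(n)}(x)=-\int_0^1\frac{t^{x-1}\ln^n t}{1-t}\,dt$; existence of $\psi^{(n)}(x)$ for general $x$ is understood as existence of the neutrix limit of the corresponding truncated integral. Here $\ln^n t=(\ln t)^n$, with $\ln^0 t=1$. *)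

(* Defs.v *)
(* Real analysis over Stdlib's R with Coquelicot. *)
From Stdlib Require Import Reals List.
From Coquelicot Require Import Coquelicot.
Open Scope R_scope.

(* For [e > 0], [Rpower e lam] is the real power e^lam, and [ln e ^ k] is
   (ln e)^k, with [ln e ^ 0 = 1]. *)
Inductive neutrix_gen : (R -> R) -> Prop :=
| neutrix_gen_pow_ln (lam : R) (r : nat) :
    lam < 0 -> (1 <= r)%nat ->
    neutrix_gen (fun e => Rpower e lam * ln e ^ (r - 1))
| neutrix_gen_ln (r : nat) :
    (1 <= r)%nat -> neutrix_gen (fun e => ln e ^ r).

Definition lin_comb (l : list (R * (R -> R))) (e : R) : R :=
  fold_right (fun p s => fst p * snd p e + s) 0 l.

(* A function on the domain 0 < e < 1/2 is encoded as a total function whose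
   values outside the domain are ignored. *)
Definition negligible (f : R -> R) : Prop :=
  exists (l : list (R * (R -> R))) (h : R -> R),
    List.Forall (fun p => neutrix_gen (snd p)) l /\
    filterlim h (at_right 0) (locally 0) /\
    forall e, 0 < e < 1 / 2 -> f e = lin_comb l e + h e.

Definition is_neutrix_lim (f : R -> R) (c : R) : Prop :=
  negligible (fun e => f e - c).

Definition ex_neutrix_lim (f : R -> R) : Prop :=
  exists c : R, is_neutrix_lim f c.

(* Main.v *)
(* The integrand has a primitive [A] on (0,1), so the truncated integral is
   [A (1 - eps) - A eps], and it suffices that both terms have neutrix limits.
   Since [t^mu / (1-t) = t^mu + t^(mu+1) / (1-t)] and the primitives of
   [t^mu ln^n t] are combinations of [t^(mu+1) ln^k t] and [ln^(n+1) t], one may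
   raise the exponent until [mu > 0]. Then [F t = t^mu ln^n t] extends continuously
   to [0], and [F t / (1-t) = F 1 / (1-t) - (F t - F 1) / (t-1)], where the last
   quotient is continuous on [0,1] and the first term only contributes
   [F 1 * ln eps]. *)
Require Import Defs.
From Stdlib Require Import Reals List Lra Lia.
From Coquelicot Require Import Coquelicot.
Open Scope R_scope.

(** * Linearity of neutrix limits and the basic sources of existence *)

Lemma lin_comb_app (l1 l2 : list (R * (R -> R))) (e : R) :
  lin_comb (l1 ++ l2) e = lin_comb l1 e + lin_comb l2 e.
Proof.
  induction l1 as [|p l1 IH]; simpl.
  - symmetry; apply Rplus_0_l.
  - unfold lin_comb in *; simpl; rewrite IH; ring.
Qed.

Lemma lin_comb_scal (a : R) (l : list (R * (R -> R))) (e : R) :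
  lin_comb (map (fun p => (a * fst p, snd p)) l) e = a * lin_comb l e.
Proof.
  induction l as [|p l IH]; unfold lin_comb in *; simpl; [ring|].
  rewrite IH; ring.
Qed.

Lemma at_right_half (P : R -> Prop) :
  (forall e, 0 < e < 1 / 2 -> P e) -> at_right 0 P.
Proof.
  intros H. exists (mkposreal (1 / 2) ltac:(lra)). intros y Hy Hy0.
  apply H. apply Rabs_def2 in Hy. unfold minus, plus, opp in Hy; simpl in Hy. lra.
Qed.

Lemma negligible_plus (f g : R -> R) :
  negligible f -> negligible g -> negligible (fun e => f e + g e).
Proof.
  intros (l1 & h1 & G1 & L1 & E1) (l2 & h2 & G2 & L2 & E2).
  exists (l1 ++ l2), (fun e => h1 e + h2 e). split; [|split].
  - apply Forall_app; split; assumption.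
  - replace 0 with (0 + 0) at 2 by ring.
    exact (filterlim_comp_2 _ _ (@plus R_AbelianMonoid) L1 L2
             (filterlim_plus (0 : R_NormedModule) (0 : R_NormedModule))).
  - intros e He. rewrite (E1 e He), (E2 e He), lin_comb_app. ring.
Qed.

Lemma negligible_scal (a : R) (f : R -> R) :
  negligible f -> negligible (fun e => a * f e).
Proof.
  intros (l & h & G & L & E).
  exists (map (fun p => (a * fst p, snd p)) l), (fun e => a * h e). split; [|split].
  - apply Forall_map. exact G.
  - replace 0 with (a * 0) at 2 by ring.
    exact (filterlim_comp _ _ _ h (fun y => a * y) _ _ _ L
             (filterlim_scal_r a (0 : R_NormedModule))).
  - intros e He. rewrite (E e He), lin_comb_scal. ring.
Qed.

Lemma ex_neutrix_lim_ext (f g : R -> R) :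
  (forall e, 0 < e < 1 / 2 -> f e = g e) -> ex_neutrix_lim f -> ex_neutrix_lim g.
Proof.
  intros Efg (c & l & h & G & L & E). exists c, l, h.
  split; [exact G | split; [exact L|]].
  intros e He. rewrite <- (Efg e He). apply E, He.
Qed.

Lemma ex_neutrix_lim_plus (f g : R -> R) :
  ex_neutrix_lim f -> ex_neutrix_lim g -> ex_neutrix_lim (fun e => f e + g e).
Proof.
  intros (c & Hf) (d & Hg). exists (c + d).
  destruct (negligible_plus _ _ Hf Hg) as (l & h & G & L & E).
  exists l, h. split; [exact G | split; [exact L|]].
  intros e He. rewrite <- (E e He). ring.
Qed.

Lemma ex_neutrix_lim_scal (a : R) (f : R -> R) :
  ex_neutrix_lim f -> ex_neutrix_lim (fun e => a * f e).
Proof.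
  intros (c & Hf). exists (a * c).
  destruct (negligible_scal a _ Hf) as (l & h & G & L & E).
  exists l, h. split; [exact G | split; [exact L|]].
  intros e He. rewrite <- (E e He). ring.
Qed.

Lemma ex_neutrix_lim_cvg (f : R -> R) (c : R) :
  filterlim f (at_right 0) (locally c) -> ex_neutrix_lim f.
Proof.
  intros L. exists c, nil, (fun e => f e - c). split; [|split].
  - constructor.
  - replace 0 with (c + - c) at 2 by ring.
    exact (filterlim_comp_2 _ _ (@plus R_AbelianMonoid) L (filterlim_const (- c))
             (filterlim_plus (c : R_NormedModule) (- c : R_NormedModule))).
  - intros e He. unfold lin_comb; simpl. ring.
Qed.

Lemma ex_neutrix_lim_continuous (f : R -> R) :
  continuous f 0 -> ex_neutrix_lim f.
Proof.
  intros Hf. apply (ex_neutrix_lim_cvg f (f 0)).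
  intros P HP. apply filter_le_within. exact (Hf P HP).
Qed.

Lemma ex_neutrix_lim_gen (f : R -> R) : neutrix_gen f -> ex_neutrix_lim f.
Proof.
  intros Hf. exists 0, ((1, f) :: nil), (fun _ => 0). split; [|split].
  - constructor; [exact Hf | constructor].
  - apply filterlim_const.
  - intros e He. unfold lin_comb; simpl. ring.
Qed.

(** * Behaviour of [Rpower t a * ln t ^ k] at 0 *)

Lemma filterlim_Rpower_0 (a : R) :
  0 < a -> filterlim (fun t => Rpower t a) (at_right 0) (locally 0).
Proof.
  intros Ha. unfold Rpower.
  apply (filterlim_comp _ _ _ (fun t => a * ln t) exp _ (Rbar_locally m_infty)).
  - apply (filterlim_comp _ _ _ ln (fun y => a * y) _ (Rbar_locally m_infty)).
    + exact is_lim_ln_0.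
    + intros P (M & HM). exists (M / a). intros y Hy. apply HM.
      apply (Rmult_lt_compat_l a) in Hy; [|exact Ha].
      replace (a * (M / a)) with M in Hy by (field; lra). exact Hy.
  - exact is_lim_exp_m.
Qed.

(** Half of the exponent absorbs the logarithm: [1 + y <= exp y] at [y = - (b / 2) * ln t] makes
    [Rpower t (b / 2) * - ln t] at most [2 / b], and the other half remains as a factor tending to
    0. *)
Lemma Rpower_ln_bound (b t : R) :
  0 < b -> 0 < t < 1 -> Rabs (Rpower t b * ln t) <= 2 / b * Rpower t (b / 2).
Proof.
  intros Hb Ht.
  assert (Hl : ln t < 0) by (rewrite <- ln_1; apply ln_increasing; lra).
  rewrite Rabs_mult, (Rabs_pos_eq (Rpower t b)) by (unfold Rpower; left; apply exp_pos).
  rewrite Rabs_left by exact Hl.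
  replace (Rpower t b) with (Rpower t (b / 2) * Rpower t (b / 2))
    by (rewrite <- Rpower_plus; f_equal; field).
  assert (H1 : Rpower t (b / 2) * - ln t <= 2 / b).
  { assert (H2 := exp_ineq1_le (b / 2 * - ln t)).
    assert (H3 : Rpower t (b / 2) * exp (b / 2 * - ln t) = 1).
    { unfold Rpower. rewrite <- exp_plus, <- exp_0. f_equal. ring. }
    assert (H4 : 0 < Rpower t (b / 2)) by apply exp_pos.
    apply (Rmult_le_reg_l (b / 2)); [lra|].
    replace (b / 2 * (2 / b)) with 1 by (field; lra).
    rewrite <- H3.
    replace (b / 2 * (Rpower t (b / 2) * - ln t))
      with (Rpower t (b / 2) * (b / 2 * - ln t)) by ring.
    apply Rmult_le_compat_l; lra. }
  assert (H4 : 0 < Rpower t (b / 2)) by apply exp_pos.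
  rewrite Rmult_assoc, Rmult_comm. apply Rmult_le_compat_r; lra.
Qed.

(** Each logarithm is paid for with half of the current exponent, so the induction on [k] has to
    range over all [a > 0]. *)
Lemma filterlim_Rpower_ln_0 (k : nat) :
  forall a, 0 < a ->
  filterlim (fun t => Rpower t a * ln t ^ k) (at_right 0) (locally 0).
Proof.
  induction k as [|k IH]; intros a Ha.
  - apply (filterlim_ext (fun t => Rpower t a)); [intros t; simpl; ring|].
    apply filterlim_Rpower_0, Ha.
  - assert (L : filterlim (fun t => Rpower t (a / 2) * ln t) (at_right 0) (locally 0)).
    { assert (L1 : filterlim (fun t => 2 / (a / 2) * Rpower t (a / 2 / 2))
                     (at_right 0) (locally 0)).
      { replace 0 with (2 / (a / 2) * 0) at 2 by ring.
        exact (filterlim_comp _ _ _ _ (fun y => 2 / (a / 2) * y) _ _ _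
                 (filterlim_Rpower_0 (a / 2 / 2) ltac:(lra))
                 (filterlim_scal_r (2 / (a / 2)) (0 : R_NormedModule))). }
      apply filterlim_locally. intros eps.
      assert (L2 := proj1 (filterlim_locally _ 0) L1 eps).
      assert (L3 := at_right_half (fun e => 0 < e < 1 / 2) (fun e He => He)).
      generalize (filter_and _ _ L2 L3). apply filter_imp.
      intros t [B Ht].
      assert (B2 := Rpower_ln_bound (a / 2) t ltac:(lra) ltac:(lra)).
      apply Rabs_def2 in B. unfold minus, plus, opp in B; simpl in B.
      change (Rabs (Rpower t (a / 2) * ln t - 0) < eps).
      rewrite Rminus_0_r. lra. }
    apply (filterlim_ext_loc (F := at_right 0)
             (fun t => (Rpower t (a / 2) * ln t ^ k) * (Rpower t (a / 2) * ln t))).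
    + apply at_right_half. intros t Ht. simpl.
      replace (Rpower t a) with (Rpower t (a / 2) * Rpower t (a / 2))
        by (rewrite <- Rpower_plus; f_equal; field).
      ring.
    + replace 0 with (0 * 0) at 2 by ring.
      refine (filterlim_comp_2 _ _ (@mult R_AbsRing) (IH (a / 2) _) L
               (filterlim_mult (0 : R_AbsRing) (0 : R_AbsRing))). lra.
Qed.

Lemma ex_neutrix_lim_ln_pow (k : nat) : ex_neutrix_lim (fun e => ln e ^ k).
Proof.
  destruct k as [|k].
  - exact (ex_neutrix_lim_cvg (fun _ => 1) 1 (filterlim_const 1)).
  - apply ex_neutrix_lim_gen, neutrix_gen_ln. lia.
Qed.

(** For [lam < 0] this is a generator with [r = S k], for [lam = 0] a power of the logarithm, and
    for [lam > 0] it tends to 0. *)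
Lemma ex_neutrix_lim_Rpower_ln (lam : R) (k : nat) :
  ex_neutrix_lim (fun e => Rpower e lam * ln e ^ k).
Proof.
  destruct (total_order_T lam 0) as [[H|H]|H].
  - apply ex_neutrix_lim_gen.
    replace k with (S k - 1)%nat by lia. apply neutrix_gen_pow_ln; [exact H | lia].
  - apply (ex_neutrix_lim_ext (fun e => ln e ^ k)).
    + intros e He. rewrite H, Rpower_O by lra. ring.
    + apply ex_neutrix_lim_ln_pow.
  - apply (ex_neutrix_lim_cvg _ 0), filterlim_Rpower_ln_0. lra.
Qed.

(** * Primitives of [Rpower t mu * ln t ^ n] *)

Lemma is_derive_Rpower_ln (mu t : R) (k : nat) :
  0 < t ->
  is_derive (fun u => Rpower u mu * ln u ^ k) t
    (mu * Rpower t (mu - 1) * ln t ^ k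
     + INR k * (Rpower t (mu - 1) * ln t ^ pred k)).
Proof.
  (* At [k = 0] the truncated [pred k] is harmless, since its term carries the factor [INR 0]. *)
  intros Ht. unfold Rpower. auto_derive; [lra|].
  replace (exp ((mu - 1) * ln t)) with (exp (mu * ln t) / t).
  - field. lra.
  - replace ((mu - 1) * ln t) with (mu * ln t + - ln t) by ring.
    rewrite exp_plus, exp_Ropp, exp_ln by exact Ht. reflexivity.
Qed.

(** For [mu = -1] the primitive is a power of the logarithm. Otherwise integration by parts lowers
    [n] by one at the cost of the factor [- INR (S n) / (mu + 1)]. *)
Lemma Rpower_ln_primitive (mu : R) (n : nat) :
  exists A : R -> R,
    (forall t, 0 < t -> is_derive A t (Rpower t mu * ln t ^ n)) /\ ex_neutrix_lim A.
Proof.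
  destruct (Req_dec mu (-1)) as [->|Hmu].
  - exists (fun t => / INR (S n) * ln t ^ S n). split.
    + intros t Ht. auto_derive; [lra|].
      (* The literal [-1] is an integer constant; it must become the opposite of 1 before
         [Rpower_Ropp] applies. *)
      replace (Rpower t (-1)) with (/ t)
        by (rewrite (opp_IZR 1 : -1 = Ropp 1), Rpower_Ropp, Rpower_1 by exact Ht; reflexivity).
      simpl pred. change (match n with O => 1 | S _ => INR n + 1 end) with (INR (S n)).
      field. split; [lra | apply not_0_INR; lia].
    + apply ex_neutrix_lim_scal, ex_neutrix_lim_ln_pow.
  - induction n as [|n (A & DA & EA)].
    + exists (fun t => / (mu + 1) * (Rpower t (mu + 1) * ln t ^ 0)). split.
      * intros t Ht.
        evar_last.
        { apply is_derive_scal, is_derive_Rpower_ln, Ht. }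
        replace (mu + 1 - 1) with mu by ring. simpl. field. lra.
      * apply ex_neutrix_lim_scal, ex_neutrix_lim_Rpower_ln.
    + exists (fun t => / (mu + 1) * (Rpower t (mu + 1) * ln t ^ S n)
                       + - (INR (S n) / (mu + 1)) * A t). split.
      * intros t Ht.
        evar_last.
        { apply @is_derive_plus.
          - apply is_derive_scal, is_derive_Rpower_ln, Ht.
          - apply is_derive_scal, DA, Ht. }
        replace (mu + 1 - 1) with mu by ring.
        unfold plus; cbn -[INR]. field. lra.
      * apply ex_neutrix_lim_plus; apply ex_neutrix_lim_scal;
          [apply ex_neutrix_lim_Rpower_ln | exact EA].
Qed.

(** * Division by [1 - t]: removing the singularity at 1 *)

Definition slope_at (F : R -> R) (a l t : R) : R :=
  if Req_EM_T t a then l else (F t - F a) / (t - a).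

Lemma continuous_slope_at (F : R -> R) (a l : R) :
  (forall t, continuous F t) -> is_derive F a l ->
  forall t, continuous (slope_at F a l) t.
Proof.
  intros CF DF t. destruct (Req_dec t a) as [->|Hta].
  - apply filterlim_locally. intros eps.
    (* In epsilon-delta form, differentiability at [a] with increment [y - a] is exactly continuity
       of the patched quotient at [a]. *)
    apply is_derive_Reals in DF.
    destruct (DF eps (cond_pos eps)) as (d & Hd).
    exists d. intros y Hy.
    change (Rabs (slope_at F a l y - slope_at F a l a) < eps).
    unfold slope_at at 2. destruct (Req_EM_T a a) as [_|]; [|tauto].
    unfold slope_at. destruct (Req_EM_T y a) as [_|Hya].
    + rewrite Rminus_eq_0, Rabs_R0. apply cond_pos.
    + specialize (Hd (y - a) ltac:(lra) Hy).
      rewrite Rplus_minus in Hd. exact Hd.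
  - apply (continuous_ext_loc _ (fun u => (F u - F a) / (u - a))).
    + assert (Hp : 0 < Rabs (t - a)) by (apply Rabs_pos_lt; lra).
      (* The radius [Rabs (t - a)] keeps [a] out of the ball, so the quotient formula holds
         throughout it. *)
      exists (mkposreal _ Hp). intros y Hy. unfold slope_at.
      destruct (Req_EM_T y a) as [->|]; [|reflexivity].
      exfalso. change (Rabs (a - t) < Rabs (t - a)) in Hy.
      rewrite Rabs_minus_sym in Hy. lra.
    + apply (continuous_mult (K := R_AbsRing) (fun u => F u - F a) (fun u => / (u - a))).
      * apply (continuous_minus (V := R_NormedModule) F (fun _ => F a));
          [apply CF | apply continuous_const].
      * apply continuous_comp.
        -- apply (continuous_minus (V := R_NormedModule) (fun u => u) (fun _ => a));
             [apply continuous_id | apply continuous_const].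
        -- apply continuous_Rinv. unfold minus, plus, opp; simpl. lra.
Qed.

Lemma div_1_minus_primitive (F : R -> R) (l : R) :
  (forall t, continuous F t) -> is_derive F 1 l ->
  exists A : R -> R,
    (forall t, 0 < t < 1 -> is_derive A t (F t / (1 - t))) /\
    ex_neutrix_lim A /\ ex_neutrix_lim (fun e => A (1 - e)).
Proof.
  intros CF DF.
  set (Q := slope_at F 1 l).
  assert (CQ : forall t, continuous Q t) by (apply continuous_slope_at; assumption).
  set (P := fun t => RInt Q 0 t).
  assert (DP : forall t, is_derive P t (Q t)).
  { intros t. apply (is_derive_RInt Q P 0); [|apply CQ].
    apply filter_forall. intros u. apply (RInt_correct Q 0 u), ex_RInt_continuous.
    intros z _. apply CQ. }
  assert (CP : forall t, continuous P t).
  { intros t. apply (ex_derive_continuous (V := R_NormedModule)). exists (Q t). apply DP. }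
  assert (C1 : forall t, continuous (fun e => 1 - e) t).
  { intros t. apply (ex_derive_continuous (V := R_NormedModule)). auto_derive. exact I. }
  exists (fun t => - F 1 * ln (1 - t) + -1 * P t). split; [|split].
  - intros t Ht.
    evar_last.
    { apply @is_derive_plus.
      - apply is_derive_scal. instantiate (1 := - / (1 - t)). auto_derive; [lra|]. field; lra.
      - apply is_derive_scal, DP. }
    unfold Q, slope_at. destruct (Req_EM_T t 1); [lra|].
    unfold plus; simpl. field. lra.
  - apply ex_neutrix_lim_plus; apply ex_neutrix_lim_scal; apply ex_neutrix_lim_continuous.
    + apply (ex_derive_continuous (V := R_NormedModule)). auto_derive. lra.
    + apply CP.
  - apply ex_neutrix_lim_plus; apply ex_neutrix_lim_scal.
    (* At [1 - e] the logarithmic term becomes a multiple of [ln e], which is negligible; the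
       integral of the slope stays continuous. *)
    + apply (ex_neutrix_lim_ext (fun e => ln e ^ 1)).
      * intros e He. rewrite pow_1. f_equal. ring.
      * apply ex_neutrix_lim_ln_pow.
    + apply ex_neutrix_lim_continuous, (continuous_comp (fun e => 1 - e) P);
        [apply C1 | apply CP].
Qed.

(** * The integrand itself and its truncated integral *)

Lemma Rpower_ln_extension_continuous (mu : R) (n : nat) :
  0 < mu -> forall t,
  continuous (fun u => if Rle_dec u 0 then 0 else Rpower u mu * ln u ^ n) t.
Proof.
  (* The value 0 on [u <= 0] is the limit from the right. The total functions would give [ln u = 0]
     and [Rpower u mu = 1] there, hence a jump when [n = 0]. *)
  intros Hmu t. set (F := fun u => _).
  destruct (total_order_T t 0) as [[H|H]|H].
  - apply (continuous_ext_loc _ (fun _ => 0)); [|apply continuous_const].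
    generalize (open_lt 0 t H). apply filter_imp. intros u Hu.
    unfold F. destruct (Rle_dec u 0); [reflexivity | lra].
  - subst t. apply filterlim_locally. intros eps.
    destruct (proj1 (filterlim_locally _ 0) (filterlim_Rpower_ln_0 n mu Hmu) eps)
      as (d & Hd).
    exists d. intros u Hu.
    unfold F. destruct (Rle_dec 0 0); [|lra].
    destruct (Rle_dec u 0); [apply ball_center | apply Hd; [exact Hu | lra]].
  - apply (continuous_ext_loc _ (fun u => Rpower u mu * ln u ^ n)).
    + generalize (open_gt 0 t H). apply filter_imp. intros u Hu.
      unfold F. destruct (Rle_dec u 0); [lra | reflexivity].
    + apply (ex_derive_continuous (V := R_NormedModule)). eexists. apply is_derive_Rpower_ln, H.
Qed.

(** Here [m] bounds the number of unit shifts that make the exponent positive; each induction step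
    trades [mu] for [mu + 1] and adds a primitive of [Rpower t mu * ln t ^ n]. *)
Lemma Rpower_ln_div_primitive (n m : nat) :
  forall mu, 0 < mu + INR m ->
  exists A : R -> R,
    (forall t, 0 < t < 1 ->
       is_derive A t (Rpower t mu / (1 - t) * ln t ^ n)) /\
    ex_neutrix_lim A /\ ex_neutrix_lim (fun e => A (1 - e)).
Proof.
  induction m as [|m IH]; intros mu Hmu.
  - simpl in Hmu. rewrite Rplus_0_r in Hmu.
    set (F := fun u => if Rle_dec u 0 then 0 else Rpower u mu * ln u ^ n).
    edestruct (div_1_minus_primitive F) as (A & DA & EA).
    + apply Rpower_ln_extension_continuous, Hmu.
    + apply (is_derive_ext_loc (fun u => Rpower u mu * ln u ^ n)).
      * generalize (open_gt 0 1 Rlt_0_1). apply filter_imp. intros u Hu.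
        unfold F. destruct (Rle_dec u 0); [lra | reflexivity].
      * apply is_derive_Rpower_ln, Rlt_0_1.
    + exists A. split; [|exact EA]. intros t Ht.
      evar_last; [apply DA, Ht|].
      unfold F. destruct (Rle_dec t 0); [lra|]. field. lra.
  - destruct (IH (mu + 1)) as (A & DA & EA & EA1).
    { rewrite S_INR in Hmu. lra. }
    destruct (Rpower_ln_primitive mu n) as (B & DB & EB).
    exists (fun t => A t + B t). split; [|split].
    + intros t Ht.
      evar_last; [apply @is_derive_plus; [apply DA | apply DB]; lra|].
      rewrite Rpower_plus, Rpower_1 by lra. unfold plus; simpl. field. lra.
    + apply ex_neutrix_lim_plus; assumption.
    + apply ex_neutrix_lim_plus; [exact EA1|].
      (* The added primitive [B] is differentiable at 1, so it has an ordinary limit at that end. *)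
      apply ex_neutrix_lim_continuous, (continuous_comp (fun e => 1 - e) B);
        apply (ex_derive_continuous (V := R_NormedModule)).
      * auto_derive. exact I.
      * eexists. apply DB. lra.
Qed.

Theorem theorem2p3 (n : nat) (x : R) :
  ex_neutrix_lim
    (fun eps => RInt (fun t => Rpower t (x - 1) / (1 - t) * ln t ^ n)
                     eps (1 - eps)).
Proof.
  (* Any [m] above [1 - x] shifts the exponent [x - 1] past 0. *)
  destruct (INR_unbounded (- (x - 1))) as (m & Hm).
  destruct (Rpower_ln_div_primitive n m (x - 1)) as (A & DA & EA & EA1); [lra|].
  apply (ex_neutrix_lim_ext (fun e => A (1 - e) + -1 * A e)).
  - intros e He. symmetry. apply is_RInt_unique.
    replace (A (1 - e) + -1 * A e) with (minus (A (1 - e)) (A e))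
      by (unfold minus, plus, opp; simpl; ring).
    (* Since [e < 1 / 2], the bounds are ordered and the closed interval lies inside (0,1), where
       [A] is a primitive and the integrand is continuous. *)
    apply (is_RInt_derive (V := R_CompleteNormedModule)); intros t Ht;
      rewrite Rmin_left, Rmax_right in Ht by lra.
    + apply DA. lra.
    + apply (ex_derive_continuous (V := R_NormedModule)). unfold Rpower. auto_derive. lra.
  - apply ex_neutrix_lim_plus; [exact EA1 | apply ex_neutrix_lim_scal, EA].
Qed.
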